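(* Let $\alpha \geq 0.28866$. Then every digraph $G$ on $n \ge 1$ vertices (without loops or parallel arcs) in which every vertex has outdegree at least $\alpha n$ contains a directed cycle of length at most $4$.
   Context: A digraph here has no loops and no parallel arcs, i.e. at most one arc $(u,v)$ for each ordered pair of distinct vertices; the two arcs $(u,v)$ and $(v,u)$ may both be present, and they form a directed cycle of length $2$. *)

(* Defs.v *)
From HB Require Import structures.
From mathcomp Require Import all_boot all_order all_algebra.
Set Implicit Arguments. Unset Strict Implicit. Unset Printing Implicit Defensive.

(* A digraph on a finite vertex type V is an arc relation e : rel V
   (at most one arc per ordered pair automatically); "no loops" is
   the hypothesis irreflexive e. *)

Definition outdeg (V : finType) (e : rel V) (x : V) : nat := #|[set y | e x y]|.

Definition has_dicycle_le (V : finType) (e : rel V) (k : nat) : Prop :=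
  exists s : seq V, [/\ 0 < size s, size s <= k, uniq s & cycle e s].

(* Main.v *)
(* Shen's averaging argument over arcs.  Pass to a smallest vertex set S inducing
   a counterexample and thin its arcs so that every outdegree is exactly r, with
   n = #|S|.  By minimality every nonempty proper subset T of S has a vertex with
   at most a * #|T| outneighbours in T.  For an arc u -> v let t be the number of
   common outneighbours.  Choosing a sparse vertex w among these, and then a sparse
   vertex x of N(v) :|: N(w), gives a set of at least r + (1 - a)(r + (1 - a) t)
   vertices at distance at most 3 from both u and v; as there is no cycle of
   length at most 4, it is disjoint from the inneighbours of v and of u.  (If t = 0, N(v)
   alone replaces N(v) :|: N(w).)  Summing
     n >= d^-(v) + q(u, v) + r + (1 - a)(r + (1 - a) t(u, v))
   over all arcs, where q counts the inneighbours of u that are not inneighbours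
   of v, and using sum q = sum (r - t) and sum t <= n r^2 / 2, one gets
   r (4 - 2 a + a^2 / 2) <= n, whereas r >= a n and 4 a - 2 a^2 + a^3 / 2 > 1
   for a = 0.28866. *)
Require Import Defs.
From HB Require Import structures.
From mathcomp Require Import all_boot all_order all_algebra.
From mathcomp Require Import ring lra.
Import Order.TTheory GRing.Theory Num.Theory.
Local Open Scope ring_scope.

(** Vertices may repeat, so no distinctness has to be checked when this is used. The first clause
    with [x = y] also excludes loops. *)
Definition no_closed_walk_le4 {V : finType} (e : rel V) : Prop :=
  [/\ forall x y, e x y -> ~~ e y x,
      forall x y z, e x y -> e y z -> ~~ e z x &
      forall x y z w, e x y -> e y z -> e z w -> ~~ e w x].

Lemma no_closed_walk_le4_sub (V : finType) (e e' : rel V) :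
  subrel e' e -> no_closed_walk_le4 e -> no_closed_walk_le4 e'.
Proof.
move=> sub [c2 c3 c4]; split.
- by move=> x y /sub /c2; apply: contra => /sub.
- by move=> x y z /sub xy /sub /(c3 _ _ _ xy); apply: contra => /sub.
- by move=> x y z w /sub xy /sub yz /sub /(c4 _ _ _ _ xy yz); apply: contra => /sub.
Qed.

Lemma no_closed_walk_le4P (V : finType) (e : rel V) :
  irreflexive e -> ~ has_dicycle_le e 4 -> no_closed_walk_le4 e.
Proof.
move=> e0 nocyc.
have neq x y : e x y -> x != y by apply: contraTneq => ->; rewrite e0.
have c2 x y : e x y -> ~~ e y x.
  move=> xy; apply/negP => yx; apply: nocyc; exists [:: x; y].
  by rewrite /= inE neq // xy yx.
have c3 x y z : e x y -> e y z -> ~~ e z x.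
  move=> xy yz; apply/negP => zx; apply: nocyc; exists [:: x; y; z].
  by rewrite /= !inE negb_or (neq x y) // (neq y z) // eq_sym (neq z x) // xy yz zx.
split=> // x y z w xy yz zw; apply/negP => wx; apply: nocyc.
exists [:: x; y; z; w].
have xz : x != z by apply: contraTneq yz => <-; apply: c2.
have yw : y != w by apply: contraTneq zw => <-; apply: c2.
rewrite /= !inE !negb_or xz yw (neq x y) // (neq y z) // (neq z w) //.
by rewrite eq_sym (neq w x) // xy yz zw wx.
Qed.

(** * The inequality attached to a single arc of a regular digraph *)

Section RegularDigraph.

Variables (R : realFieldType) (a : R) (V : finType) (e : rel V) (S : {set V}).
Variable r : nat.
Hypothesis a_ge0 : 0 <= a.
Hypothesis a_le1 : a <= 1.
Hypothesis walk_free : no_closed_walk_le4 e.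
Hypothesis arcS : forall x y, e x y -> (x \in S) && (y \in S).
Hypothesis r_gt0 : (0 < r)%N.

Let N x := [set y | e x y].
Let M x := [set y | e y x].

Hypothesis regular : forall x, x \in S -> #|N x| = r.
Hypothesis sparse : forall T : {set V}, T \proper S -> T != set0 ->
  exists2 w, w \in T & #|N w :&: T|%:R <= a * #|T|%:R.

Lemma out_sub x : N x \subset S.
Proof. by apply/subsetP => y; rewrite inE => /arcS /andP[]. Qed.

Lemma in_sub x : M x \subset S.
Proof. by apply/subsetP => y; rewrite inE => /arcS /andP[]. Qed.

(** Every vertex of [X] is reached from both [u] and [v] in at most two steps, so an arc from it to
    an inneighbour of either would close a walk of length at most 4. *)
Lemma extend_by_sparse_vertex (u v : V) : e u v ->
  exists X : {set V}, [/\ N v \subset X, X \subset S,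
    forall y z, y \in X -> z \in M v :|: M u -> (y != z) && ~~ e y z &
    r%:R + (1 - a) * #|N u :&: N v|%:R <= #|X|%:R :> R].
Proof.
have [c2 c3 c4] := walk_free.
move=> uv; have /andP[uS vS] := arcS _ _ uv.
have near_v y z : y \in N v -> z \in M v :|: M u -> (y != z) && ~~ e y z.
  rewrite !inE => vy /orP[zv|zu]; apply/andP; split.
  - by apply: contraTneq zv => <-; apply: c2.
  - by apply: contraL zv; apply: c3.
  - by apply: contraTneq uv => yz; apply: (c3 _ y); rewrite // yz.
  - by apply: contraL uv => yz; apply: (c4 _ y z).
have [/eqP T0|Tn0] := boolP (N u :&: N v == set0).
  exists (N v); split; rewrite ?out_sub //.
  by rewrite T0 cards0 mulr0 addr0 (regular _ vS).
have Tproper : N u :&: N v \proper S.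
  apply/properP; split; first by rewrite subIset // out_sub.
  exists v => //; rewrite !inE negb_and; apply/orP; right.
  by apply/negP => vv; move/negP: (c2 _ _ vv).
have [w wT wsparse] := sparse _ Tproper Tn0.
move: wT; rewrite !inE => /andP[uw vw].
have /andP[_ wS] := arcS _ _ uw.
exists (N v :|: N w); split; rewrite ?subsetUl ?subUset ?out_sub //.
- move=> y z; rewrite inE => /orP[|]; first exact: near_v.
  rewrite !inE => wy /orP[zv|zu]; apply/andP; split.
  + by apply: contraTneq zv => <-; apply: (c3 _ w).
  + by apply: contraL zv => yz; apply: (c4 _ w y).
  + by apply: contraTneq zu => <-; apply: (c3 _ w).
  + by apply: contraL zu => yz; apply: (c4 _ w y).
have cNv : (#|N u :&: N v| + #|N v :\: N u| = r)%N.
  by rewrite setIC cardsID; apply: regular.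
have cU : (#|N v :|: N w| + #|N v :&: N w| = r + r)%N.
  by rewrite cardsUI !regular.
(* Sparsity of [w] bounds the first term by [a * t], with [t] the size of [N u :&: N v]; the second
   is [r - t]. Hence the union has at least [2 r - a t - (r - t)] elements. *)
have cI : (#|N v :&: N w| <= #|N w :&: (N u :&: N v)| + #|N v :\: N u|)%N.
  rewrite (leq_trans _ (leq_card_setU _ _)) ?subset_leq_card //.
  by apply/subsetP => y; rewrite !inE => /andP[-> ->]; case: (e u y).
move: cNv cU cI wsparse => /(congr1 (fun k => k%:R : R)) + /(congr1 (fun k => k%:R : R)).
rewrite -(ler_nat R) !natrD; lra.
Qed.

Lemma arc_inequality (u v : V) : e u v ->
  #|M v|%:R + #|M u :\: M v|%:R + r%:R
    + (1 - a) * (r%:R + (1 - a) * #|N u :&: N v|%:R) <= #|S|%:R :> R.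
Proof.
move=> uv; have /andP[uS vS] := arcS _ _ uv.
have [X [NvX XS Xfar Xlarge]] := extend_by_sparse_vertex _ _ uv.
have Xn0 : X != set0.
  rewrite -card_gt0 (leq_trans r_gt0) // -(regular _ vS) subset_leq_card //.
have Xproper : X \proper S.
  (* [u] is an inneighbour of [v], and [X] avoids those. *)
  apply/properP; split=> //; exists u => //; apply/negP => uX.
  by have := Xfar u u uX; rewrite !inE uv eqxx => /(_ isT).
have [x xX xsparse] := sparse _ Xproper Xn0.
have disj : [disjoint X :|: N x & M v :|: M u].
  apply/pred0P => y /=; apply/negP => /andP[yXN yM].
  move: yXN; rewrite inE => /orP[yX|].
    by have := Xfar y y yX yM; rewrite eqxx.
  by rewrite inE => xy; have := Xfar x y xX yM; rewrite xy andbF.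
have cS : (#|X :|: N x| + #|M v :|: M u| <= #|S|)%N.
  rewrite -(eqP (etrans (leq_card_setU _ _).2 disj)).
  by rewrite subset_leq_card // !subUset XS out_sub !in_sub.
have cM : (#|M v| + #|M u :\: M v| = #|M v :|: M u|)%N.
  apply/eqP; rewrite -(eqn_add2r #|M v :&: M u|) cardsUI -addnA eqn_add2l.
  by rewrite addnC setIC cardsID.
have cX := cardsUI X (N x).
rewrite setIC (regular _ (subsetP XS x xX)) in cX.
move: cS cM cX => + /(congr1 (fun k => k%:R : R)) + /(congr1 (fun k => k%:R : R)).
rewrite -(ler_nat R) !natrD.
have : (1 - a) * (r%:R + (1 - a) * #|N u :&: N v|%:R) <= (1 - a) * #|X|%:R.
  by rewrite ler_wpM2l // subr_ge0.
lra.
Qed.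

(** * Double counting over all arcs *)

Lemma sum_indicator (A : {set V}) (p : pred V) :
  \sum_(x in A) (p x)%:R = #|[set x in A | p x]|%:R :> R.
Proof.
rewrite -sum1_card natr_sum big_mkcond [RHS]big_mkcond /=.
by apply: eq_bigr => x _; rewrite inE; case: (x \in A) => //; case: (p x).
Qed.

Lemma sum_arcs_swap (F : V -> V -> R) :
  \sum_(u in S) \sum_(v in N u) F u v = \sum_(v in S) \sum_(u in M v) F u v.
Proof.
rewrite (exchange_big_dep (mem S)) /=; last by move=> u v _; rewrite inE => /arcS /andP[].
apply: eq_bigr => v _; apply: eq_bigl => u.
by rewrite !inE andbC; case uv: (e u v) => //=; have /andP[] := arcS _ _ uv.
Qed.

Lemma sum_arcs_const (c : R) :
  \sum_(u in S) \sum_(v in N u) c = c * (#|S|%:R * r%:R).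
Proof.
under eq_bigr => u uS do rewrite sumr_const regular //.
by rewrite sumr_const -[c *+ r *+ _]mulr_natr -[c *+ r]mulr_natr -mulrA [r%:R * _]mulrC.
Qed.

(** Grouping arcs by head gives the sum of squared indegrees. Since indegrees average to [r],
    summing [(d - r)^2 >= 0] suffices. *)
Lemma sum_indegree_ge :
  #|S|%:R * r%:R ^+ 2 <= \sum_(u in S) \sum_(v in N u) #|M v|%:R :> R.
Proof.
have sumM : \sum_(v in S) #|M v|%:R = #|S|%:R * r%:R :> R.
  rewrite -[RHS]mul1r -sum_arcs_const sum_arcs_swap.
  by apply: eq_bigr => v _; rewrite sumr_const.
rewrite sum_arcs_swap.
have : \sum_(v in S) (2 * r%:R * #|M v|%:R - r%:R ^+ 2) <=
       \sum_(v in S) \sum_(u in M v) #|M v|%:R :> R.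
  apply: ler_sum => v _; rewrite sumr_const -mulr_natr.
  have := sqr_ge0 (#|M v|%:R - r%:R : R); lra.
rewrite sumrB -mulr_sumr sumM sumr_const -mulr_natr; lra.
Qed.

(** Both sides count the walks [x -> u -> v] without an arc [x -> v], grouped by the second arc on
    the left and by the first on the right. *)
Lemma sum_new_inneighbours :
  \sum_(u in S) \sum_(v in N u) #|M u :\: M v|%:R =
  \sum_(u in S) \sum_(v in N u) (r%:R - #|N u :&: N v|%:R) :> R.
Proof.
transitivity (\sum_(u in S) \sum_(x in M u) \sum_(v in N u) (~~ e x v)%:R : R).
  apply: eq_bigr => u _; rewrite exchange_big; apply: eq_bigr => v _ /=.
  rewrite sum_indicator; congr _%:R.
  by apply: eq_card => x; rewrite !inE andbC.
rewrite -(sum_arcs_swap (fun x u => \sum_(v in N u) (~~ e x v)%:R)).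
apply: eq_bigr => x _; apply: eq_bigr => u; rewrite inE => /arcS /andP[_ uS].
rewrite sum_indicator -(regular _ uS) -(cardsID (N x) (N u)) natrD setIC addrC addKr.
by congr _%:R; apply: eq_card => v; rewrite !inE andbC.
Qed.

(** The inner sum counts the arcs inside [N u]; without 2-cycles, an ordered pair and its reverse
    contribute at most 1 together. *)
Lemma sum_common_outneighbours_le :
  2 * \sum_(u in S) \sum_(v in N u) #|N u :&: N v|%:R <= #|S|%:R * r%:R ^+ 2 :> R.
Proof.
have [c2 _ _] := walk_free.
rewrite mulr_sumr mulrC mulr_natr -sumr_const; apply: ler_sum => u uS.
have tE : \sum_(v in N u) #|N u :&: N v|%:R =
          \sum_(v in N u) \sum_(w in N u) (e v w)%:R :> R.
  apply: eq_bigr => v _; rewrite sum_indicator; congr _%:R.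
  by apply: eq_card => w; rewrite !inE.
rewrite mulr_natl mulr2n {2}tE exchange_big tE -big_split /=.
have -> : r%:R ^+ 2 = \sum_(v in N u) \sum_(w in N u) 1 :> R.
  by rewrite !sumr_const regular // expr2 mulr_natr.
apply: ler_sum => v _; rewrite -big_split; apply: ler_sum => w _ /=.
by rewrite -natrD lern1; case vw: (e v w); rewrite ?(negPf (c2 _ _ vw)) // leq_b1.
Qed.

Lemma regular_outdegree_bound : S != set0 ->
  r%:R * (4 - 2 * a + a ^+ 2 / 2) <= #|S|%:R :> R.
Proof.
move=> Sn0; have inn := sum_indegree_ge; have tle := sum_common_outneighbours_le.
have : \sum_(u in S) \sum_(v in N u) (#|M v|%:R + #|M u :\: M v|%:R + r%:R
    + (1 - a) * (r%:R + (1 - a) * #|N u :&: N v|%:R)) <=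
  \sum_(u in S) \sum_(v in N u) #|S|%:R :> R.
  apply: ler_sum => u _; apply: ler_sum => v; rewrite inE; exact: arc_inequality.
rewrite sum_arcs_const.
set tsum := \sum_(u in S) \sum_(v in N u) #|N u :&: N v|%:R in tle *.
set msum := \sum_(u in S) \sum_(v in N u) #|M v|%:R in inn *.
have qE : \sum_(u in S) \sum_(v in N u) #|M u :\: M v|%:R =
    r%:R * (#|S|%:R * r%:R) - tsum.
  rewrite sum_new_inneighbours -sum_arcs_const -sumrB.
  by apply: eq_bigr => u _; rewrite sumrB.
have -> : \sum_(u in S) \sum_(v in N u) (#|M v|%:R + #|M u :\: M v|%:R + r%:R
    + (1 - a) * (r%:R + (1 - a) * #|N u :&: N v|%:R)) =
    msum + (r%:R * (#|S|%:R * r%:R) - tsum)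
    + (r%:R + (1 - a) * r%:R) * (#|S|%:R * r%:R) + (1 - a) ^+ 2 * tsum :> R.
  rewrite -qE -sum_arcs_const mulr_sumr -!big_split /=; apply: eq_bigr => u _.
  rewrite mulr_sumr -!big_split /=; apply: eq_bigr => v _; ring.
have r0 : 0 < r%:R :> R by rewrite ltr0n.
have S0 : 0 < #|S|%:R :> R by rewrite ltr0n card_gt0.
move=> total; rewrite -(ler_pM2l (mulr_gt0 S0 r0)).
(* The total coefficient of [tsum] is [(1 - a)^2 - 1 = - a (2 - a)], which is nonpositive, so the
   upper bound on [tsum] applies. *)
have a2 : 0 <= 2 - a by rewrite subr_ge0 (le_trans a_le1) // ler1n.
have := ler_wpM2l (mulr_ge0 a_ge0 a2) tle.
lra.
Qed.

End RegularDigraph.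

(** Strong induction on the size of [S]. The relation is quantified after [S] because the induction
    hypothesis is applied to the thinned relation [e']. *)
Lemma sparse_vertex (R : realFieldType) (a : R) (V : finType) :
  0 <= a -> a <= 1 -> 1 < a * (4 - 2 * a + a ^+ 2 / 2) ->
  forall (S : {set V}) (e : rel V), no_closed_walk_le4 e -> S != set0 ->
  exists2 w, w \in S & #|[set y | e w y] :&: S|%:R < a * #|S|%:R.
Proof.
move=> a0 a1 aP S; have [n] := ubnP #|S|; elim: n S => // n IHn S leSn e ewf Sn0.
have [/exists_inP[w wS ws]|] :=
  boolP [exists w in S, #|[set y | e w y] :&: S|%:R < a * #|S|%:R]; first by exists w.
rewrite negb_exists_in => /forall_inP dense.
have [x0 x0S] := set0Pn _ Sn0.
have Sgt0 : 0 < #|S|%:R :> R by rewrite ltr0n card_gt0.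
have agt0 : 0 < a by rewrite lt_def a0 andbT; apply: contraTneq aP => ->; rewrite mul0r ltr10.
pose d x := #|[set y | e x y] :&: S|.
case: (arg_minnP d x0S) => x1 x1S x1min.
pose r := d x1.
have rdense : a * #|S|%:R <= r%:R by rewrite leNgt dense.
have rgt0 : (0 < r)%N by rewrite -(ltr_nat R) (lt_le_trans _ rdense) // mulr_gt0.
(* Any [r] outneighbours inside [S] will do, [r] being the least outdegree there; the empty value
   outside [S] keeps all arcs within [S]. *)
pose f x := if x \in S then [set y in take r (enum ([set y | e x y] :&: S))] else set0.
have fP x y : y \in f x -> [/\ e x y, x \in S & y \in S].
  rewrite /f; case: ifP => xS; last by rewrite inE.
  by rewrite inE => /mem_take; rewrite mem_enum !inE => /andP[].
pose e' x y := y \in f x.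
have e'sub : subrel e' e by move=> x y /fP[].
have e'wf := no_closed_walk_le4_sub _ _ _ e'sub ewf.
have bound : r%:R * (4 - 2 * a + a ^+ 2 / 2) <= #|S|%:R :> R.
  apply: (@regular_outdegree_bound R a V e' S r) => //.
  - by move=> x y /fP[_ -> ->].
  - move=> x xS; have -> : [set y | e' x y] = f x by apply/setP => y; rewrite inE.
    rewrite /f xS cardsE.
    rewrite (card_uniqP _) ?take_uniq ?enum_uniq // size_takel // -cardE.
    exact: x1min.
  move=> T TS Tn0.
  have ltTn : (#|T| < n)%N by rewrite (leq_trans (proper_card TS)).
  by have [w wT /ltW] := IHn T ltTn e' e'wf Tn0; exists w.
have c0 : 0 < 4 - 2 * a + a ^+ 2 / 2.
  by rewrite -(pmulr_rgt0 _ agt0) (lt_trans _ aP).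
have := le_trans (ler_wpM2r (ltW c0) rdense) bound.
by rewrite mulrAC ger_pMl // leNgt aP.
Qed.

Theorem theorem1p2 (R : realFieldType) (alpha : R)
  (halpha : (28866%:R / 100000%:R : R) <= alpha)
  (V : finType) (e : rel V)
  (hn : (0 < #|V|)%N)
  (hloop : irreflexive e)
  (hdeg : forall x : V, alpha * (#|V|)%:R <= (outdeg e x)%:R) :
  has_dicycle_le e 4.
Proof.
(* A boolean search over tuples of length below 5 makes the case split decidable. *)
have [/existsP[n /existsP[s /and3P[n0 us cs]]]|nocyc] :=
    boolP [exists n : 'I_5, exists s : n.-tuple V, [&& (0 < n)%N, uniq s & cycle e s]].
  by exists s; split; rewrite ?size_tuple // -ltnS.
have ewf : no_closed_walk_le4 e.
  apply: no_closed_walk_le4P => // -[s [s0 s4 us cs]]; case/negP: nocyc.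
  apply/existsP; exists (Ordinal (s4 : (size s < 5)%N)).
  by apply/existsP; exists (in_tuple s); rewrite s0 us.
have Vn0 : [set: V] != set0 by rewrite -card_gt0 cardsT.
(* The constant itself is used instead of [alpha], so that the numerical side conditions are closed
   inequalities. *)
have [|||w _] := @sparse_vertex R (28866%:R / 100000%:R) V _ _ _ [set: V] e ewf Vn0.
- lra.
- lra.
- lra.
rewrite setIT cardsT ltNge => /negP[].
by rewrite (le_trans _ (hdeg w)) // ler_wpM2r.
Qed.
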